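(* Let $\mathcal H$ be a real Hilbert space, let $\Phi:\mathcal H\to\mathbb{R}\cup\{+\infty\}$ be proper, lower semicontinuous and convex, and let $B:\mathcal H\to\mathcal H$ be $\beta$-cocoercive with $\beta>0$. Let $\mu,h$ be real numbers with $0<\mu<2\beta$ and $0<h<\delta:=\frac12+\inf\{1,\frac{\beta}{\mu}\}$. Suppose that $S=\{z\in\mathcal H:\ \partial\Phi(z)+Bz\ni0\}$ is nonempty. Let $(x_k,y_k)_{k\in\mathbb N}$ be a sequence generated, from an arbitrary $y_0\in\mathcal H$, by $$x_k=\mathrm{prox}_{\mu\Phi}(y_k),\qquad y_{k+1}=(1-h)y_k+h\,(x_k-\mu B(x_k)).$$ Then: a) $(y_k)$ converges weakly to an element $\bar y$ with $\mathrm{prox}_{\mu\Phi}(\bar y)\in S$; b) $(x_k)$ converges weakly to $\bar x=\mathrm{prox}_{\mu\Phi}(\bar y)$, with $\bar x\in S$; c) $B(x_k)$ converges strongly to $B\bar x$; d) $\sum_k\|x_k-x_{k-1}\|^2<\infty$ and $\sum_k\|y_k-y_{k-1}\|^2<\infty$; in particular $x_k-x_{k-1}$ and $y_k-y_{k-1}$ converge strongly to zero; e) $y_k-x_k$ converges strongly in $\mathcal H$.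
   Context: $\partial\Phi$ is the convex subdifferential and $\mathrm{prox}_{\mu\Phi}=(I+\mu\partial\Phi)^{-1}$ is the proximal mapping of $\mu\Phi$ (single-valued, defined on all of $\mathcal H$). $B:\mathcal H\to\mathcal H$ is $\beta$-cocoercive if $\langle Bx-By,x-y\rangle\ge\beta\|Bx-By\|^2$ for all $x,y\in\mathcal H$. *)

(* Defs.v *)
From HB Require Import structures.
From mathcomp Require Import all_boot all_order all_algebra.
From mathcomp Require Import all_classical all_reals all_analysis.

Set Implicit Arguments.
Unset Strict Implicit.
Unset Printing Implicit Defensive.

Import Order.TTheory GRing.Theory Num.Theory.
Import numFieldNormedType.Exports.

Local Open Scope classical_set_scope.
Local Open Scope ring_scope.

(* A real Hilbert space is a complete normed module H over a realType together
   with dot : {dot H for idfun}, a symmetric positive definite bilinear form,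
   such that hilbert_dot dot holds: the norm of H is the one induced by dot. *)
Definition hilbert_dot (R : realType) (H : completeNormedModType R)
    (dot : {dot H for idfun}) : Prop :=
  forall x : H, `|x| ^+ 2 = dot x x.

Definition weak_cvg (R : realType) (H : completeNormedModType R)
    (dot : {dot H for idfun}) (u : nat -> H) (l : H) : Prop :=
  forall w : H, (fun k => dot (u k) w) @ \oo --> dot l w.

(* Functions into R U {+oo} are represented as functions into \bar R that never
   take the value -oo; this is part of properness. *)
Definition proper_fun (R : realType) (H : completeNormedModType R)
    (Phi : H -> \bar R) : Prop :=
  (forall x, Phi x != -oo%E) /\ (exists x, Phi x != +oo%E).

Definition convex_efun (R : realType) (H : completeNormedModType R)
    (Phi : H -> \bar R) : Prop :=
  forall (x y : H) (t : R), 0 < t -> t < 1 ->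
    (Phi (t *: x + (1 - t) *: y)%R <= t%:E * Phi x + (1 - t)%:E * Phi y)%E.

(* When Phi is proper, this set is empty at every x with Phi x = +oo, by taking
   z in the domain of Phi. *)
Definition subdifferential (R : realType) (H : completeNormedModType R)
    (dot : {dot H for idfun}) (Phi : H -> \bar R) (x : H) : set H :=
  [set u | forall z : H, (Phi x + (dot u (z - x))%:E <= Phi z)%E].

(* (I + mu A)^-1 for a set-valued operator A. *)
Definition resolvent (R : realType) (H : completeNormedModType R)
    (mu : R) (A : H -> set H) (y : H) : set H :=
  [set x | [set x + mu *: u | u in A x] y].

(* For Phi proper, lower semicontinuous and convex and 0 < mu, the resolvent of
   the subdifferential is a singleton at every point, and prox picks its
   element; [get] would return an arbitrary point on an empty set. *)
Definition prox (R : realType) (H : completeNormedModType R)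
    (dot : {dot H for idfun}) (mu : R) (Phi : H -> \bar R) (y : H) : H :=
  get (resolvent mu (subdifferential dot Phi) y).

Definition cocoercive (R : realType) (H : completeNormedModType R)
    (dot : {dot H for idfun}) (beta : R) (B : H -> H) : Prop :=
  forall x y : H, beta * `|B x - B y| ^+ 2 <= dot (B x - B y) (x - y).

Definition inclusion_sols (R : realType) (H : completeNormedModType R)
    (dot : {dot H for idfun}) (Phi : H -> \bar R) (B : H -> H) : set H :=
  [set z | [set u + B z | u in subdifferential dot Phi z] 0].

(* Main.v *)
(* Write J for the proximal mapping and v_k = y_k - x_k. Fixed points p of
   y |-> J y - mu B (J y) correspond to solutions J p. Firm nonexpansiveness of J
   and cocoercivity of B give, with m = min(1, beta / mu),
     |y_(k+1) - p|^2 <= |y_k - p|^2 - h (2 m - h - |1 - h|)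
       (|v_k - (p - J p)|^2 + mu^2 |B x_k - B (J p)|^2),
   and the factor 2 m - h - |1 - h| is positive exactly when h < 1/2 + m (given
   mu < 2 beta and 0 < h). Hence |y_k - p| is nonincreasing, v_k and B x_k
   converge strongly, and the increments are square summable. A weak cluster
   point l of (y_k) is again fixed: x_k = y_k - v_k has the cluster point
   l - (p - J p), and the strong limits of v_k and B x_k let one pass to the
   limit in the monotonicity of J and the cocoercivity of B. Opial's lemma then
   gives weak convergence. Cluster points are taken along ultrafilters: for
   bounded (y_k) the limits of dot (y_k) w define a bounded linear form in w,
   represented by Riesz's theorem. *)
Require Import Defs.
From HB Require Import structures.
From mathcomp Require Import all_boot all_order all_algebra.
From mathcomp Require Import all_classical all_reals all_analysis.
From mathcomp Require Import ring lra.

Set Implicit Arguments.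
Unset Strict Implicit.
Unset Printing Implicit Defensive.

Import Order.TTheory GRing.Theory Num.Theory.
Import numFieldNormedType.Exports.

Local Open Scope classical_set_scope.
Local Open Scope ring_scope.

(** * Ultrafilter test for convergence and telescoping sums *)

(** If the preimage of a neighbourhood of [l] is not in [F], its complement is compatible with [F];
    an ultrafilter containing both would also contain the preimage. *)
Lemma cvg_ultra (T : Type) (X : topologicalType) (F : set_system T)
    (FF : Filter F) (f : T -> X) (l : X) :
  (forall U : set_system T, UltraFilter U -> F `<=` U -> f @ U --> l) ->
  f @ F --> l.
Proof.
move=> fU A lA; apply: contrapT => nFA.
set B := f @^-1` A.
have PB : ProperFilter (within (~` B) F).
  apply: Build_ProperFilter_ex => P FP; apply: contrapT => nP; apply: nFA.
  have {}FP : F [set t | ~ B t -> P t] := FP.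
  change (F B); apply: filterS FP => t /= Pt; apply: contrapT => nBt; apply: nP.
  by exists t; apply: Pt.
have [U [UU sFU]] := @ultraFilterLemma _ _ PB.
have sU : F `<=` U.
  move=> P FP; apply: sFU.
  by change (F [set t | ~ B t -> P t]); apply: filterS FP => t Pt _.
have UB : U B by exact: fU lA.
have UnB : U (~` B) by apply: sFU; exact: withinT.
by have [t []] := @filter_ex _ U _ _ (filterI UB UnB).
Qed.

Lemma summable_telescope (R : realType) (a u : nat -> R) :
  (forall k, 0 <= u k) -> (forall k, 0 <= a k) ->
  (forall k, u k <= a k - a k.+1) -> cvgn (series u).
Proof.
move=> u0 a0 ua; apply: nondecreasing_is_cvgn.
  exact/nondecreasing_series.
exists (a 0%N) => _ [n _ <-].
suff : series u n <= a 0%N - a n by have := a0 n; lra.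
elim: n => [|n IHn]; first by rewrite seriesEord/= big_ord0 subrr.
by rewrite /series/= big_nat_recr//=; have := ua n; rewrite /series/= in IHn; lra.
Qed.

(** * Inner product: algebra, Cauchy-Schwarz, limits *)

Section hilbert_space.
Context {R : realType} {H : completeNormedModType R}.
Variables (dot : {dot H for idfun}) (Hdot : hilbert_dot dot).

Lemma dotC u v : dot u v = dot v u.
Proof. by have := hermC dot u v; rewrite expr0 mul1r. Qed.

Lemma dotDl u v w : dot (u + v) w = dot u w + dot v w.
Proof. by rewrite linearDl. Qed.

Lemma dotDr w u v : dot w (u + v) = dot w u + dot w v.
Proof. by rewrite dotC dotDl !(dotC w). Qed.

Lemma dotNl u w : dot (- u) w = - dot u w.
Proof. by rewrite linearNl. Qed.

Lemma dotNr w u : dot w (- u) = - dot w u.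
Proof. by rewrite dotC dotNl (dotC w). Qed.

Lemma dotZl a u w : dot (a *: u) w = a * dot u w.
Proof. by rewrite linearZl_LR. Qed.

Lemma dotZr w a u : dot w (a *: u) = a * dot w u.
Proof. by rewrite dotC dotZl (dotC w). Qed.

Lemma dot0r w : dot w 0 = 0.
Proof. by rewrite -(scale0r 0) dotZr mul0r. Qed.

Definition dotE := (dotDl, dotDr, dotNl, dotNr, dotZl, dotZr).

Lemma dot_ge0 u : 0 <= dot u u.
Proof. by rewrite -Hdot exprn_ge0. Qed.

Lemma dot_eq0 u : dot u u = 0 -> u = 0.
Proof. by rewrite -Hdot => /eqP; rewrite sqrf_eq0 normr_eq0 => /eqP. Qed.

(** Cauchy-Schwarz: the squared norm of [dot v v *: u - dot u v *: v] is [dot v v] times the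
    difference of the two squared sides. *)
Lemma dot_normM u v : `|dot u v| <= `|u| * `|v|.
Proof.
have [->|v0] := eqVneq v 0; first by rewrite dot0r !normr0 mulr0.
have v2 : 0 < dot v v by rewrite -Hdot exprn_gt0// normr_gt0.
have := dot_ge0 (dot v v *: u - dot u v *: v).
rewrite !dotE (dotC v u) => d0.
rewrite -(@ler_pXn2r _ 2)// ?nnegrE ?mulr_ge0// exprMn !Hdot real_normK ?num_real//.
rewrite -subr_ge0 -(pmulr_rge0 _ v2).
by apply: le_trans d0 _; rewrite le_eqVlt; apply/orP; left; apply/eqP; ring.
Qed.

Lemma cvg_dot (T : Type) (F : set_system T) {FF : Filter F} (v : T -> H)
    (m w : H) : v @ F --> m -> (fun k => dot (v k) w) @ F --> dot m w.
Proof.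
move=> vm; have vm0 : `|v k - m| @[k --> F] --> (0 : R).
  by apply/norm_cvg0P/subr_cvg0.
apply/subr_cvg0; apply/norm_cvg0P.
have h0 : (fun k => `|v k - m| * `|w|) @ F --> (0 : R).
  by have := cvgM vm0 (cvg_cst `|w|); rewrite mul0r; apply.
apply: squeeze_cvgr (cvg_cst 0) h0; near=> k.
by rewrite normr_ge0/= -dotNl -dotDl dot_normM.
Unshelve. all: by end_near. Qed.

(** Split [v k = m + (v k - m)]: the first part is covered by the weak limit, the second vanishes by
    Cauchy-Schwarz and the bound [M]. *)
Lemma cvg_dot_weak (T : Type) (F : set_system T) {FF : Filter F}
    (u v : T -> H) (l m : H) (M : R) : (forall k, `|u k| <= M) ->
  (forall w, (fun k => dot (u k) w) @ F --> dot l w) -> v @ F --> m ->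
  (fun k => dot (u k) (v k)) @ F --> dot l m.
Proof.
move=> uM ul vm; have vm0 : `|v k - m| @[k --> F] --> (0 : R).
  by apply/norm_cvg0P/subr_cvg0.
have -> : (fun k => dot (u k) (v k)) =
    (fun k => dot (u k) m + dot (u k) (v k - m)).
  by apply/funext => k; rewrite -dotDr addrC subrK.
rewrite -[dot l m]addr0; apply: cvgD; first exact: ul.
apply/norm_cvg0P.
have h0 : (fun k => M * `|v k - m|) @ F --> (0 : R).
  by have := cvgM (cvg_cst M) vm0; rewrite mulr0; apply.
apply: squeeze_cvgr (cvg_cst 0) h0; near=> k.
rewrite normr_ge0/=; apply: le_trans (dot_normM _ _) _.
by rewrite ler_wpM2r.
Unshelve. all: by end_near. Qed.

(** * Convex functions and their quadratic perturbation *)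

Lemma proper_fineK (Phi : H -> \bar R) (z : H) : proper_fun Phi ->
  Phi z != +oo%E -> ((fine (Phi z))%:E)%E = Phi z.
Proof. by move=> [Phi_ninfty _] zoo; rewrite fineK// fin_numE Phi_ninfty. Qed.

Lemma convex_fine (Phi : H -> \bar R) (a b : H) (t : R) :
  proper_fun Phi -> convex_efun Phi -> 0 < t -> t < 1 ->
  Phi a != +oo%E -> Phi b != +oo%E ->
  Phi (t *: a + (1 - t) *: b) != +oo%E /\
  fine (Phi (t *: a + (1 - t) *: b)) <=
    t * fine (Phi a) + (1 - t) * fine (Phi b).
Proof.
move=> pPhi cPhi t0 t1 aoo boo; have := cPhi a b _ t0 t1.
rewrite -(proper_fineK pPhi aoo) -(proper_fineK pPhi boo) /= => le_ab.
have coo : Phi (t *: a + (1 - t) *: b) != +oo%E.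
  by apply/eqP => coo; rewrite coo in le_ab.
by split=> //; rewrite -lee_fin proper_fineK.
Qed.

Lemma midpoint_sqr_dist (a b y : H) :
  `|2^-1 *: a + (1 - 2^-1) *: b - y| ^+ 2 =
  (`|a - y| ^+ 2 + `|b - y| ^+ 2) / 2 - `|a - b| ^+ 2 / 4.
Proof.
by rewrite !Hdot !dotE (dotC b a) (dotC y a) (dotC y b); field.
Qed.

(* By the parallelogram identity any minimizing sequence is Cauchy. *)
Lemma quadratic_minimizer (Phi : H -> \bar R) (y : H) (c m : R) :
  proper_fun Phi -> lower_semicontinuous Phi -> convex_efun Phi -> 0 < c ->
  (forall z, (m%:E <= Phi z + (c * `|z - y| ^+ 2)%:E)%E) ->
  exists2 p, Phi p != +oo%E & forall z, Phi z != +oo%E ->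
    fine (Phi p) + c * `|p - y| ^+ 2 <= fine (Phi z) + c * `|z - y| ^+ 2.
Proof.
move=> pPhi lPhi cPhi c0 mPhi.
pose D := [set z | Phi z != +oo%E].
pose g z := fine (Phi z) + c * `|z - y| ^+ 2.
pose I := inf (g @` D).
have hI : has_inf (g @` D).
  split; first by have [_ [z zoo]] := pPhi; exists (g z), z.
  exists m => _ [z Dz <-].
  by have := mPhi z; rewrite -(proper_fineK pPhi Dz) lee_fin.
have I_le z : D z -> I <= g z.
  by move=> Dz; apply: ge_inf; [exact: hI.2 | exists z].
have /choice[u uP] (n : nat) : exists z, D z /\ g z < I + n.+1%:R^-1.
  have n0 : 0 < n.+1%:R^-1 :> R by rewrite invr_gt0.
  by have [_ [z Dz <-] gz] := inf_adherent n0 hI; exists z.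
have u_dist n k : (n <= k)%N -> `|u n - u k| ^+ 2 <= 4 / c * n.+1%:R^-1.
  move=> nk; have [Dn gn] := uP n; have [Dk gk] := uP k.
  have kn : k.+1%:R^-1 <= n.+1%:R^-1 :> R.
    by rewrite lef_pV2 ?posrE// ler_nat.
  have [||Dmid mid] := @convex_fine Phi (u n) (u k) 2^-1 pPhi cPhi _ _ Dn Dk.
  - lra.
  - lra.
  have := I_le _ Dmid; rewrite /g midpoint_sqr_dist => I_mid.
  rewrite mulrAC ler_pdivlMr//; rewrite /g in gn gk.
  move: mid I_mid gn gk kn; move: (n.+1%:R^-1) (k.+1%:R^-1) => en ek.
  by move: (fine _) (fine _) (fine _) (_ ^+ 2) (_ ^+ 2) (_ ^+ 2) => *; lra.
have u_cvg : cvgn u.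
  apply/cauchy_cvgP.
  apply: cauchy_exP => e e0.
  have e20 : 0 < c / 4 * e ^+ 2 by rewrite mulr_gt0 ?divr_gt0 ?exprn_gt0.
  have [N _ NP] := near_infty_natSinv_lt (PosNum e20).
  exists (u N); exists N => // k /= Nk.
  rewrite -ball_normE /= -(@ltr_pXn2r _ 2)// ?nnegrE ?normr_ge0 ?(ltW e0)//.
  apply: le_lt_trans (u_dist _ _ Nk) _.
  have /= := NP N (leqnn _); rewrite -(@ltr_pM2l _ (4 / c)) ?divr_gt0//.
  by rewrite mulrA [_ * (c / 4)](_ : _ = 1) ?mul1r//; field; exact: lt0r_neq0.
pose p := lim (u @ \oo).
have Phi_p : (Phi p <= (I - c * `|p - y| ^+ 2)%:E)%E.
  (* If this fails, lower semicontinuity gives some [a > I - c |p - y|^2] below [Phi (u n)] for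
     large [n]; this contradicts [g (u n) < I + 1 / (n + 1)] in the limit. *)
  rewrite leNgt; apply/negP => I_lt.
  have [a Ia aPhi] : exists2 a, I - c * `|p - y| ^+ 2 < a & (a%:E < Phi p)%E.
    move: I_lt; case: (Phi p) => [r| |//].
    - rewrite lte_fin => I_lt.
      by exists ((I - c * `|p - y| ^+ 2 + r) / 2); rewrite ?lte_fin; lra.
    - by exists (I - c * `|p - y| ^+ 2 + 1); rewrite ?ltry//; lra.
  have [V Vp VP] := lPhi _ _ aPhi.
  suff : a + c * `|p - y| ^+ 2 <= I + 0 by lra.
  have cvgl : (fun n => a + c * `|u n - y| ^+ 2) @ \oo -->
      a + c * `|p - y| ^+ 2.
    apply: cvgD; first exact: cvg_cst.
    apply: cvgM; first exact: cvg_cst.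
    rewrite expr2; under eq_fun do rewrite expr2.
    have uy : `|u n - y| @[n --> \oo] --> `|p - y|.
      by apply: cvg_norm; apply: cvgB; [exact: u_cvg | exact: cvg_cst].
    exact: (cvgM uy uy).
  have cvgr : (fun n => I + n.+1%:R^-1) @ \oo --> I + 0.
    by apply: cvgD; [exact: cvg_cst | exact: cvg_harmonic].
  apply: ler_cvg_to cvgl cvgr _; near=> n.
  have [Dn gn] := uP n; apply: le_trans (ltW gn).
  rewrite lerD2r -lee_fin (proper_fineK pPhi Dn) ltW//; apply: VP.
  by near: n; exact: u_cvg.
have Dp : D p by apply/eqP => poo; rewrite poo in Phi_p.
exists p => // z Dz; apply: le_trans (I_le z Dz).
by move: Phi_p; rewrite -(proper_fineK pPhi Dp) lee_fin; lra.
Unshelve. all: by end_near. Qed.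

(** Stands in for letting [t] tend to 0: a positive [A] is refuted by [t = A / (2 A + K)], for which
    [t K < A]. *)
Lemma ler0_of_small (A K : R) : 0 <= K ->
  (forall t, 0 < t -> t < 1 -> A <= t * K) -> A <= 0.
Proof.
move=> K0 AK; rewrite leNgt; apply/negP => A0.
have d0 : 0 < 2 * A + K by lra.
have := AK (A / (2 * A + K)); rewrite divr_gt0// ltr_pdivrMr// mulrAC ler_pdivlMr//.
by move=> /(_ isT); nra.
Qed.

(** Fermat's rule at the minimizer [p]: compare it with [t z + (1 - t) p], divide by [t] and let [t]
    tend to 0; the remaining quadratic term is of order [t]. *)
Lemma quadratic_subgradient (Phi : H -> \bar R) (y : H) (mu m : R) :
  proper_fun Phi -> lower_semicontinuous Phi -> convex_efun Phi -> 0 < mu ->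
  (forall z, (m%:E <= Phi z + ((2 * mu)^-1 * `|z - y| ^+ 2)%:E)%E) ->
  exists p, subdifferential dot Phi p (mu^-1 *: (y - p)).
Proof.
move=> pPhi lPhi cPhi mu0 mPhi.
have c0 : 0 < (2 * mu)^-1 by rewrite invr_gt0 mulr_gt0.
have [p Dp p_min] := quadratic_minimizer pPhi lPhi cPhi c0 mPhi.
exists p => z.
have [->|Dz] := eqVneq (Phi z) +oo%E; first by rewrite leey.
rewrite -(proper_fineK pPhi Dp) -(proper_fineK pPhi Dz) -EFinD lee_fin -subr_le0.
have K0 : 0 <= (2 * mu)^-1 * dot (z - p) (z - p).
  by rewrite mulr_ge0 ?dot_ge0// ltW.
apply: (ler0_of_small K0) => t t0 t1; rewrite -(ler_pM2l t0).
have [Dt tle] := convex_fine pPhi cPhi t0 t1 Dz Dp.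
have := p_min _ Dt.
have -> : t *: z + (1 - t) *: p - y = (p - y) + t *: (z - p).
  by rewrite scalerBl scale1r scalerBr addrCA addrAC.
rewrite !Hdot => min_t.
have -> : mu^-1 = 2 * (2 * mu)^-1 by field; exact: lt0r_neq0.
move: min_t tle; rewrite dotZl !(dotDl (p - y)) !(dotDr _ (p - y)) !dotZl !dotZr.
rewrite (dotC (z - p) (p - y)) -(opprB p y) dotNl.
by move: (fine _) (fine _) (fine _) (dot _ _) (dot _ _) (dot _ _) => *; lra.
Qed.

(** * Riesz representation, weak compactness, Opial's lemma *)

(* The minimizer of [- f z + |z|^2 / 2] represents [f]. *)
Lemma riesz_representation (f : H -> R) (M : R) :
  (forall u v, f (u + v) = f u + f v) -> (forall a u, f (a *: u) = a * f u) ->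
  (forall u, `|f u| <= M * `|u|) -> exists l, forall w, f w = dot l w.
Proof.
move=> fD fZ fM; pose Phi z := (- f z)%:E.
have fN u : f (- u) = - f u by rewrite -scaleN1r fZ mulN1r.
have f_cont z : f @ z --> f z.
  apply/subr_cvg0/norm_cvg0P.
  have h0 : (fun x => M * `|x - z|) @ z --> (0 : R).
    have z0 : `|x - z| @[x --> z] --> (0 : R).
      by apply/norm_cvg0P/subr_cvg0; exact: cvg_id.
    by have := cvgM (cvg_cst M) z0; rewrite mulr0; apply.
  apply: squeeze_cvgr (cvg_cst 0) h0; near=> x.
  by rewrite normr_ge0/= -fN -fD fM.
have pPhi : proper_fun Phi by split=> //; exists 0.
have lPhi : lower_semicontinuous Phi.
  move=> z a; rewrite lte_fin => az; exists [set x | a < - f x] => //.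
  by apply: (cvgr_gt (- f z)) az; apply: cvgN; exact: f_cont.
have cPhi : convex_efun Phi.
  move=> a b t t0 t1; rewrite /Phi -!EFinM -EFinD lee_fin fD !fZ.
  by rewrite le_eqVlt; apply/orP; left; apply/eqP; ring.
(* The bound is the minimum of [- M t + t^2 / 2] over real [t]. *)
have mPhi z : ((- (M ^+ 2 / 2))%:E <=
    Phi z + ((2 * 1)^-1 * `|z - 0| ^+ 2)%:E)%E.
  rewrite -EFinD lee_fin subr0 mulr1; have := fM z; rewrite ler_norml => /andP[_].
  by have := sqr_ge0 (M - `|z|); move: `|z| (f z) => *; nra.
have [p p_sub] := quadratic_subgradient pPhi lPhi cPhi ltr01 mPhi.
(* The subgradient of [- f] at [p] is [- p], tested at [p + w]; the reverse inequality comes from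
   [- w]. *)
have f_le w : f w <= dot p w.
  have := p_sub (p + w).
  rewrite invr1 scale1r sub0r addrAC subrr add0r -EFinD lee_fin fD dotNl; lra.
exists p => w; apply/eqP; rewrite eq_le f_le /=.
by have := f_le (- w); rewrite fN dotNr lerN2.
Unshelve. all: by end_near. Qed.

Lemma weak_compact (T : Type) (U : set_system T) (u : T -> H) (M : R) :
  UltraFilter U -> (forall k, `|u k| <= M) ->
  exists l, forall w, (fun k => dot (u k) w) @ U --> dot l w.
Proof.
move=> UU uM.
have dotM k w : `|dot (u k) w| <= M * `|w|.
  by apply: le_trans (dot_normM _ _) _; rewrite ler_wpM2r.
have /choice[f fP] w : exists a : R,
    (fun k => dot (u k) w) @ U --> a /\ `|a| <= M * `|w|.
  have UM : ((fun k => dot (u k) w) @ U) [set` `[- (M * `|w|), M * `|w|]].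
    apply: (@filterE _ U) => k /=; rewrite in_itv/= -ler_norml; exact: dotM.
  have [a [/= aM a_cl]] := segment_compact _ UM.
  exists a; split; last by rewrite ler_norml; move: aM; rewrite in_itv.
  (* An ultrafilter converges to its cluster points: it contains the preimage of [A] or its
     complement, and clustering excludes the latter. *)
  move=> A aA; have [//|UnA] := in_ultra_setVsetC ((fun k => dot (u k) w) @^-1` A) UU.
  by have [r []] := a_cl (~` A) A UnA aA.
have [l fl] : exists l, forall w, f w = dot l w.
  apply: (@riesz_representation f M).
  - move=> v w; have := (fP (v + w)).1; under eq_fun do rewrite dotDr.
    by move=> /cvg_unique; apply => //; exact: cvgD (fP v).1 (fP w).1.
  - move=> a w; have := (fP (a *: w)).1; under eq_fun do rewrite dotZr.
    by move=> /cvg_unique; apply => //; exact: cvgM (cvg_cst _) (fP w).1.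
  - by move=> w; exact: (fP w).2.
by exists l => w; rewrite -fl; exact: (fP w).1.
Qed.

(* Along [\oo], [dot (y k) (p - q)] converges for [p, q] in [F], because the
   distances to [p] and [q] do; so two weak cluster points in [F] coincide. *)
Lemma opial (F : set H) (y : nat -> H) : F !=set0 ->
  (forall p, F p -> cvgn (fun k => `|y k - p| ^+ 2)) ->
  (forall (U : set_system nat) l, UltraFilter U -> \oo `<=` U ->
    (forall w, (fun k => dot (y k) w) @ U --> dot l w) -> F l) ->
  exists2 l, F l & weak_cvg dot y l.
Proof.
move=> [q Fq] cvgF clF.
have [M yM] : exists M, forall k, `|y k| <= M.
  have [M [_ /(_ (M + 1))]] := cvg_seq_bounded (cvgF q Fq).
  rewrite ltrDl ltr01 => /(_ isT) yqM; exists (M + 2 + `|q|) => k.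
  have := yqM k I; rewrite /= ger0_norm ?exprn_ge0// => yq2.
  have yq : `|y k - q| <= M + 2.
    by have := sqr_ge0 (`|y k - q| - 1); move: yq2; move: (`|y k - q|) => d; nra.
  by have := ler_normD (y k - q) q; rewrite subrK; lra.
have [U0 [UU0 sU0]] := ultraFilterLemma (@eventually_filter).
have [l0 l0P] := weak_compact UU0 yM.
have Fl0 := clF _ _ UU0 sU0 l0P.
(* It remains to see that every ultrafilter finer than [\oo] yields the same weak limit as [U0]. *)
exists l0 => // w; apply: cvg_ultra => U UU sU.
have [l lP] := weak_compact UU yM.
have Fl := clF _ _ UU sU lP.
suff -> : l0 = l by exact: lP.
have dot_cvg : cvgn (fun k => dot (y k) (l0 - l)).
  have -> : (fun k => dot (y k) (l0 - l)) = (fun k => 2^-1 *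
      (`|y k - l| ^+ 2 - `|y k - l0| ^+ 2 + (dot l0 l0 - dot l l))).
    by apply/funext => k; rewrite !Hdot !dotE (dotC l) (dotC l0 (y k)); field.
  apply: (cvgP (2^-1 * (lim (`|y k - l| ^+ 2 @[k --> \oo]) -
    lim (`|y k - l0| ^+ 2 @[k --> \oo]) + (dot l0 l0 - dot l l)))).
  apply: cvgM; first exact: cvg_cst.
  apply: cvgD; last exact: cvg_cst.
  by apply: cvgB; exact: cvgF.
have e0 := cvg_unique (@norm_hausdorff _ _) (l0P (l0 - l)) (cvg_trans (cvg_app _ sU0) dot_cvg).
have e1 := cvg_unique (@norm_hausdorff _ _) (lP (l0 - l)) (cvg_trans (cvg_app _ sU) dot_cvg).
apply/eqP; rewrite -subr_eq0; apply/eqP/dot_eq0.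
by rewrite dotDl dotNl e0 e1 subrr.
Qed.

(** * Subdifferential and proximal mapping *)

Lemma subdifferential_dom (Phi : H -> \bar R) (x u : H) :
  proper_fun Phi -> subdifferential dot Phi x u -> Phi x != +oo%E.
Proof.
move=> pPhi xu; apply/eqP => xoo; have [_ [z zoo]] := pPhi.
by have := xu z; rewrite xoo -(proper_fineK pPhi zoo).
Qed.

Lemma subdifferential_monotone (Phi : H -> \bar R) (x z u v : H) :
  proper_fun Phi -> subdifferential dot Phi x u ->
  subdifferential dot Phi z v -> 0 <= dot (u - v) (x - z).
Proof.
move=> pPhi xu zv; have xd := subdifferential_dom pPhi xu.
have zd := subdifferential_dom pPhi zv; move: (xu z) (zv x).
rewrite -(proper_fineK pPhi xd) -(proper_fineK pPhi zd) -!EFinD !lee_fin.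
by rewrite dotDl dotNl -(opprB z x) !dotNr; lra.
Qed.

(* A subgradient at one point gives an affine minorant, hence the lower bound
   on [Phi + |. - y|^2 / (2 mu)]. *)
Lemma prox_subdifferential (Phi : H -> \bar R) (mu : R) (z u y : H) :
  proper_fun Phi -> lower_semicontinuous Phi -> convex_efun Phi -> 0 < mu ->
  subdifferential dot Phi z u ->
  subdifferential dot Phi (prox dot mu Phi y)
    (mu^-1 *: (y - prox dot mu Phi y)).
Proof.
move=> pPhi lPhi cPhi mu0 zu; have zd := subdifferential_dom pPhi zu.
(* The minimum over [w] of the affine minorant plus [|w - y|^2 / (2 mu)], attained at
   [w = y - mu u]. *)
pose m := fine (Phi z) + dot u (y - z) - mu / 2 * dot u u.
have mPhi w : (m%:E <= Phi w + ((2 * mu)^-1 * `|w - y| ^+ 2)%:E)%E.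
  have [->|wd] := eqVneq (Phi w) +oo%E; first by rewrite leey.
  have := zu w; rewrite -(proper_fineK pPhi zd) -(proper_fineK pPhi wd).
  rewrite -!EFinD !lee_fin /m -(subrKA y w) (addrC _ (y - z)) dotDr Hdot => zuw.
  have c0 : 0 < (2 * mu)^-1 by rewrite invr_gt0 mulr_gt0.
  have := dot_ge0 ((w - y) + mu *: u); rewrite -(pmulr_rge0 _ c0).
  move: zuw; rewrite !(dotDl (w - y)) !(dotDr _ (w - y)) !dotZl !dotZr.
  rewrite (dotC (w - y) u) => zuw.
  rewrite [X in 0 <= X -> _](_ : _ = (2 * mu)^-1 * dot (w - y) (w - y) +
      dot u (w - y) + mu / 2 * dot u u); last by field; exact: lt0r_neq0.
  lra.
have [p pP] := quadratic_subgradient pPhi lPhi cPhi mu0 mPhi.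
have : resolvent mu (subdifferential dot Phi) y (prox dot mu Phi y).
  apply: getPex; exists p; exists (mu^-1 *: (y - p)) => //.
  by rewrite scalerA divff ?lt0r_neq0// scale1r addrC subrK.
move=> [v vP yE]; rewrite -[X in mu^-1 *: (X - _)]yE addrAC subrr add0r.
by rewrite scalerA mulVf ?lt0r_neq0// scale1r.
Qed.

(** Monotonicity applied to the subgradients [(y - J y) / mu] and [(y' - J y') / mu], with [J] the
    proximal mapping; [zu] supplies the affine minorant behind them. *)
Lemma prox_firm (Phi : H -> \bar R) (mu : R) (z u y y' : H) :
  proper_fun Phi -> lower_semicontinuous Phi -> convex_efun Phi -> 0 < mu ->
  subdifferential dot Phi z u ->
  0 <= dot (prox dot mu Phi y - prox dot mu Phi y')
    (y - prox dot mu Phi y - (y' - prox dot mu Phi y')).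
Proof.
move=> pPhi lPhi cPhi mu0 zu.
have J w := prox_subdifferential w pPhi lPhi cPhi mu0 zu.
have := subdifferential_monotone pPhi (J y) (J y').
by rewrite dotC -scalerBr dotZr pmulr_rge0// invr_gt0.
Qed.

Lemma prox_nonexpansive (Phi : H -> \bar R) (mu : R) (z u y y' : H) :
  proper_fun Phi -> lower_semicontinuous Phi -> convex_efun Phi -> 0 < mu ->
  subdifferential dot Phi z u ->
  `|prox dot mu Phi y - prox dot mu Phi y'| ^+ 2 <= `|y - y'| ^+ 2.
Proof.
move=> pPhi lPhi cPhi mu0 zu.
have := prox_firm y y' pPhi lPhi cPhi mu0 zu.
set a := prox _ _ _ _ - _; set b := y - _ - _.
have -> : y - y' = a + b by rewrite /a /b opprB addrA (addrC (_ - _) (y - _)) !subrKA.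
move: a b => a b.
by have := dot_ge0 b; rewrite !Hdot !dotE (dotC b a); lra.
Qed.

(** Monotonicity between [u] at [z] and the subgradient at the proximal point [q] gives
    [- |z - q|^2 / mu >= 0]. *)
Lemma prox_uniq (Phi : H -> \bar R) (mu : R) (z u : H) :
  proper_fun Phi -> lower_semicontinuous Phi -> convex_efun Phi -> 0 < mu ->
  subdifferential dot Phi z u -> prox dot mu Phi (z + mu *: u) = z.
Proof.
move=> pPhi lPhi cPhi mu0 zu.
have := subdifferential_monotone pPhi zu
  (prox_subdifferential (z + mu *: u) pPhi lPhi cPhi mu0 zu).
set q := prox _ _ _ _; rewrite addrAC scalerDr scalerA mulVf ?lt0r_neq0//.
rewrite scale1r opprD addrCA subrr addr0 dotNl dotZl oppr_ge0 pmulr_rle0 ?invr_gt0//.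
move=> qz; apply/esym/eqP; rewrite -subr_eq0; apply/eqP/dot_eq0.
by apply/eqP; rewrite eq_le qz dot_ge0.
Qed.

(** * One-step estimate *)

(** Isolates the algebra of one iteration: [p], [v], [c] stand for the differences of proximal
    points, residuals and values of [mu B] between an iterate and a fixed point. *)
Lemma averaged_step (p v c : H) (kappa h : R) : 0 < h ->
  0 <= dot p v -> kappa * `|c| ^+ 2 <= dot p c ->
  `|p + v - h *: (v + c)| ^+ 2 <= `|p + v| ^+ 2 -
    h * (2 * Num.min 1 kappa - h - `|1 - h|) * (`|v| ^+ 2 + `|c| ^+ 2).
Proof.
move=> h0; rewrite !Hdot => pv pc; set m := Num.min 1 kappa.
have m1 : m <= 1 by rewrite ge_min lexx.
have mk : m <= kappa by rewrite ge_min lexx orbT.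
have v0 := dot_ge0 v; have c0 := dot_ge0 c.
have vDc := dot_ge0 (v + c); have vBc := dot_ge0 (v - c).
rewrite !dotE (dotC c v) in vDc vBc.
(* Expanding the square leaves a cross term of unknown sign; [|v + c|^2 >= 0] or [|v - c|^2 >= 0]
   absorbs it, according to the sign of [1 - h]. *)
have hX : - (`|1 - h| * (dot v v + dot c c)) <= 2 * (1 - h) * dot v c.
  have [h1|h1] := ger0P (1 - h); first by have := mulr_ge0 h1 vDc; lra.
  have h1' : 0 <= h - 1 by lra.
  by have := mulr_ge0 h1' vBc; lra.
have mv : m * dot v v <= dot v v by rewrite -[leRHS]mul1r ler_wpM2r.
have mc : m * dot c c <= dot p c by apply: le_trans pc; rewrite ler_wpM2r.
suff : h * ((2 * m - h - `|1 - h|) * (dot v v + dot c c)) <=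
    h * (2 * (dot p v + dot p c + dot v v + dot v c) -
         h * (dot v v + 2 * dot v c + dot c c)).
  by rewrite !dotE (dotC v p) (dotC c v) (dotC c p); lra.
by rewrite ler_pM2l//; lra.
Qed.

(** With [m] the minimum, the value is [2 m - 1] for [h <= 1], positive as [kappa > 1 / 2], and
    [2 m + 1 - 2 h] for [h > 1], positive by the bound on [h]. *)
Lemma step_size_gt0 (kappa h : R) : 1 / 2 < kappa ->
  h < 1 / 2 + Num.min 1 kappa -> 0 < 2 * Num.min 1 kappa - h - `|1 - h|.
Proof.
move=> k2 h_lt; have : 1 / 2 < Num.min 1 kappa by rewrite lt_min k2 andbT; lra.
by move: (Num.min 1 kappa) h_lt => m h_lt m2; have [h1|h1] := ger0P (1 - h); lra.
Qed.

Lemma sqr_norm_cvg0 (T : Type) (F : set_system T) {FF : Filter F}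
    (u : T -> H) :
  (fun k => `|u k| ^+ 2) @ F --> (0 : R) -> u @ F --> (0 : H).
Proof.
move=> u2; apply/cvgr0Pnorm_lt => e e0.
have e20 : 0 < e ^+ 2 by rewrite exprn_gt0.
have /cvgr0Pnorm_lt/(_ _ e20) := u2; apply: filterS => k.
by rewrite ger0_norm ?exprn_ge0// ltr_pXn2r ?nnegrE ?normr_ge0 ?(ltW e0).
Qed.

(** * The forward-backward iteration *)

Section forward_backward.
Variables (Phi : H -> \bar R) (Phi_proper : proper_fun Phi).
Variables (Phi_lsc : lower_semicontinuous Phi) (Phi_convex : convex_efun Phi).
Variables (B : H -> H) (beta : R) (B_coco : cocoercive dot beta B).
Variables (mu h : R) (beta_gt0 : 0 < beta) (mu_gt0 : 0 < mu).
Variables (mu_lt : mu < 2 * beta) (h_gt0 : 0 < h).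
Variable h_lt : h < 1 / 2 + Num.min 1 (beta / mu).
Variables (z0 u0 : H) (z0u0 : subdifferential dot Phi z0 u0).
Variables (x y : nat -> H) (x_def : forall k, x k = prox dot mu Phi (y k)).
Variable y_rec : forall k,
  y k.+1 = (1 - h) *: y k + h *: (x k - mu *: B (x k)).

Let J := prox dot mu Phi.

(* Fixed points of [y |-> J y - mu B (J y)], written through the residual
   [y - J y], which is what the Fejer inequality controls. *)
Definition fb_fixpoint : set H := [set p | p - J p = - (mu *: B (J p))].

Let gain := 2 * Num.min 1 (beta / mu) - h - `|1 - h|.

Let gain_gt0 : 0 < gain.
Proof. by apply: step_size_gt0 h_lt; rewrite ltr_pdivlMr// mul1r mulrC ltr_pdivrMr// mulrC. Qed.

Lemma fb_fixpoint_sols p : fb_fixpoint p -> inclusion_sols dot Phi B (J p).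
Proof.
move=> pF; exists (mu^-1 *: (p - J p)).
  exact: prox_subdifferential Phi_proper Phi_lsc Phi_convex mu_gt0 z0u0.
by rewrite pF scalerN scalerA mulVf ?lt0r_neq0// scale1r addNr.
Qed.

(** Provides the first reference point for the Fejer estimates from a solution. *)
Lemma fb_fixpoint_of_sol z u : subdifferential dot Phi z u -> u + B z = 0 ->
  fb_fixpoint (z + mu *: u).
Proof.
move=> zu uB.
have Jz : J (z + mu *: u) = z.
  exact: prox_uniq Phi_proper Phi_lsc Phi_convex mu_gt0 zu.
rewrite /fb_fixpoint /= Jz addrAC subrr add0r -scalerN.
by congr (_ *: _); apply/eqP; rewrite -addr_eq0 uB.
Qed.

Let v k := y k - x k.

Let step k : y k.+1 = y k - h *: (v k + mu *: B (x k)).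
Proof.
rewrite y_rec scalerBl scale1r /v !scalerDr !scalerN opprD opprB -!addrA.
by congr (_ + _); rewrite addrCA.
Qed.

Lemma fejer p k : fb_fixpoint p ->
  h * gain * (`|v k - (p - J p)| ^+ 2 +
    `|mu *: B (x k) - mu *: B (J p)| ^+ 2) <=
  `|y k - p| ^+ 2 - `|y k.+1 - p| ^+ 2.
Proof.
move=> pF; set w := v k - _; set c := mu *: _ - _.
have wE : y k - p = (x k - J p) + w.
  by rewrite /w /v opprB addrA (addrC (_ - _) (y k - _)) !subrKA.
(* Since [p - J p + mu B (J p) = 0], the direction [v k + mu B (x k)] equals [w + c]. *)
have yE : y k.+1 - p = (x k - J p) + w - h *: (w + c).
  rewrite -wE step addrAC; congr (_ - _ *: _).
  by rewrite /w /c pF addrACA -opprD addNr oppr0 addr0.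
have xw : 0 <= dot (x k - J p) w.
  rewrite /w /v x_def.
  exact: prox_firm Phi_proper Phi_lsc Phi_convex mu_gt0 z0u0.
(* [mu B] is cocoercive with constant [beta / mu]. *)
have xc : beta / mu * `|c| ^+ 2 <= dot (x k - J p) c.
  rewrite /c -scalerBr normrZ exprMn real_normK ?num_real// dotZr dotC.
  rewrite [leLHS](_ : _ = mu * (beta * `|B (x k) - B (J p)| ^+ 2)).
    by rewrite ler_pM2l.
  by field; exact: lt0r_neq0.
by have := averaged_step h_gt0 xw xc; rewrite -yE -wE -/gain; lra.
Qed.

Let fejer_le p : fb_fixpoint p -> forall k,
  `|y k.+1 - p| ^+ 2 <= `|y k - p| ^+ 2.
Proof.
move=> pF k; rewrite -subr_ge0; apply: le_trans (fejer k pF).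
by rewrite mulr_ge0 ?addr_ge0 ?sqr_ge0// mulr_ge0// ltW.
Qed.

Lemma fejer_cvg p : fb_fixpoint p -> cvgn (fun k => `|y k - p| ^+ 2).
Proof.
move=> pF; apply: nonincreasing_is_cvgn.
  by apply/nonincreasing_seqP; exact: fejer_le.
by exists 0 => _ [n _ <-]; exact: sqr_ge0.
Qed.

(** The Fejer inequality telescopes with potential [K / (h gain) |y k - p|^2]; [K] is 1 for the
    residual and operator terms, [2 h^2] for the increments. *)
Lemma fejer_summable p (K : R) (s : nat -> R) : fb_fixpoint p -> 0 <= K ->
  (forall k, 0 <= s k) ->
  (forall k, s k <= K * (`|v k - (p - J p)| ^+ 2 +
    `|mu *: B (x k) - mu *: B (J p)| ^+ 2)) -> cvgn (series s).
Proof.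
move=> pF K0 s0 sle; have hg : 0 < h * gain by rewrite mulr_gt0.
apply: (@summable_telescope _ (fun k => K / (h * gain) * `|y k - p| ^+ 2)) => //.
  by move=> k; rewrite mulr_ge0 ?sqr_ge0// divr_ge0 ?(ltW hg).
move=> k; apply: le_trans (sle k) _.
rewrite -mulrBr -mulrA ler_wpM2l// mulrC ler_pdivlMr// mulrC.
exact: fejer.
Qed.

Lemma residual_cvg p : fb_fixpoint p -> v @ \oo --> p - J p.
Proof.
move=> pF; apply/subr_cvg0; apply: sqr_norm_cvg0; apply: cvg_series_cvg_0.
apply: (fejer_summable pF ler01) => k; first exact: sqr_ge0.
by rewrite mul1r lerDl sqr_ge0.
Qed.

Lemma operator_cvg p : fb_fixpoint p -> (fun k => B (x k)) @ \oo --> B (J p).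
Proof.
move=> pF; have muB : (fun k => mu *: B (x k)) @ \oo --> mu *: B (J p).
  apply/subr_cvg0; apply: sqr_norm_cvg0; apply: cvg_series_cvg_0.
  apply: (fejer_summable pF ler01) => k; first exact: sqr_ge0.
  by rewrite mul1r lerDr sqr_ge0.
have muVK (w : H) : mu^-1 *: (mu *: w) = w.
  by rewrite scalerA mulVf ?lt0r_neq0// scale1r.
rewrite -(muVK (B (J p))).
have -> : (fun k => B (x k)) = (fun k => mu^-1 *: (mu *: B (x k))).
  by apply/funext => k; rewrite muVK.
by apply: cvgZ muB; exact: cvg_cst.
Qed.

Lemma increment_le p k : fb_fixpoint p ->
  `|y k.+1 - y k| ^+ 2 <= 2 * h ^+ 2 * (`|v k - (p - J p)| ^+ 2 +
    `|mu *: B (x k) - mu *: B (J p)| ^+ 2).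
Proof.
move=> pF; set w := v k - _; set c := mu *: _ - _.
have -> : y k.+1 - y k = - (h *: (w + c)).
  by rewrite step addrAC subrr add0r /w /c pF addrACA -opprD addNr oppr0 addr0.
rewrite normrN normrZ exprMn real_normK ?num_real//.
rewrite [leRHS](_ : _ = h ^+ 2 * (2 * (`|w| ^+ 2 + `|c| ^+ 2))); last by ring.
apply: ler_wpM2l; first exact: sqr_ge0.
move: w c => w c; have := dot_ge0 (w - c).
by rewrite !Hdot !dotE (dotC c w); lra.
Qed.

Lemma y_increments_summable p : fb_fixpoint p ->
  cvgn (series (fun k => `|y k.+1 - y k| ^+ 2)).
Proof.
move=> pF; apply: (@fejer_summable _ (2 * h ^+ 2) _ pF) => [|k|k].
- by rewrite mulr_ge0 ?sqr_ge0.
- exact: sqr_ge0.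
- exact: increment_le.
Qed.

Lemma x_increments_summable p : fb_fixpoint p ->
  cvgn (series (fun k => `|x k.+1 - x k| ^+ 2)).
Proof.
move=> pF; apply: (@fejer_summable _ (2 * h ^+ 2) _ pF) => [|k|k].
- by rewrite mulr_ge0 ?sqr_ge0.
- exact: sqr_ge0.
- apply: le_trans (increment_le k pF); rewrite !x_def.
  exact: prox_nonexpansive Phi_proper Phi_lsc Phi_convex mu_gt0 z0u0.
Qed.

Lemma weak_cluster_fixpoint p (U : set_system nat) (l : H) : fb_fixpoint p ->
  UltraFilter U -> \oo `<=` U ->
  (forall w, (fun k => dot (y k) w) @ U --> dot l w) -> fb_fixpoint l.
Proof.
move=> pF UU sU yl.
have vU : v @ U --> p - J p := cvg_trans (cvg_app _ sU) (residual_cvg pF).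
have BU : (fun k => B (x k)) @ U --> B (J p) :=
  cvg_trans (cvg_app _ sU) (operator_cvg pF).
(* The weak limit of [x k = y k - v k] along [U]. *)
pose xt := l - (p - J p).
have xl w : (fun k => dot (x k) w) @ U --> dot xt w.
  have -> : (fun k => dot (x k) w) = (fun k => dot (y k) w - dot (v k) w).
    by apply/funext => k; rewrite -dotNl -dotDl /v subKr.
  rewrite /xt dotDl dotNl; apply: cvgB; first exact: yl.
  exact: cvg_dot.
have yM k : `|y k - p| ^+ 2 <= `|y 0%N - p| ^+ 2.
  by elim: k => [//|k]; apply: le_trans; exact: fejer_le.
have xM k : `|x k - J l| <= `|y 0%N - p| + `|J p - J l|.
  rewrite -(subrKA (J p)); apply: le_trans (ler_normD _ _) _.
  rewrite lerD2r -(@ler_pXn2r _ 2)// ?nnegrE// x_def.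
  apply: le_trans (yM k).
  exact: prox_nonexpansive Phi_proper Phi_lsc Phi_convex mu_gt0 z0u0.
have xlJ w : (fun k => dot (x k - J l) w) @ U --> dot (xt - J l) w.
  have -> : (fun k => dot (x k - J l) w) = (fun k => dot (x k) w - dot (J l) w).
    by apply/funext => k; rewrite -dotNl -dotDl.
  rewrite dotDl dotNl; apply: cvgB; [exact: xl | exact: cvg_cst].
have xtE : xt = J l.
  apply/eqP; rewrite -subr_eq0; apply/eqP/dot_eq0/eqP.
  rewrite eq_le dot_ge0 andbT -oppr_ge0 -dotNr.
  (* By this identity, firm nonexpansiveness becomes [- |xt - J l|^2 >= 0] in the limit. *)
  have -> : - (xt - J l) = p - J p - (l - J l).
    by rewrite /xt; move: (p - J p) => a; rewrite !opprB addrCA.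
  have vl : (fun k => v k - (l - J l)) @ U --> p - J p - (l - J l).
    by apply: cvgB => //; exact: cvg_cst.
  apply: cvgr_to_ge (cvg_dot_weak xM xlJ vl) _; apply: filterE => k.
  rewrite /v x_def.
  exact: prox_firm Phi_proper Phi_lsc Phi_convex mu_gt0 z0u0.
(* In the limit, cocoercivity bounds [beta |B (J p) - B (J l)|^2] by an inner product with
   [xt - J l = 0]. *)
have BE : B (J p) = B (J l).
  have Bl : (fun k => B (x k) - B (J l)) @ U --> B (J p) - B (J l).
    by apply: cvgB => //; exact: cvg_cst.
  apply/eqP; rewrite -subr_eq0; apply/eqP/dot_eq0/eqP.
  rewrite eq_le dot_ge0 andbT.
  have nB : `|B (x k) - B (J l)| @[k --> U] --> `|B (J p) - B (J l)|.
    exact: cvg_norm.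
  have lhs : beta * (`|B (x k) - B (J l)| * `|B (x k) - B (J l)|) @[k --> U]
      --> beta * (`|B (J p) - B (J l)| * `|B (J p) - B (J l)|).
    by apply: cvgM; [exact: cvg_cst | exact: (cvgM nB nB)].
  have rhs : dot (x k - J l) (B (x k) - B (J l)) @[k --> U] -->
    dot (xt - J l) (B (J p) - B (J l)) by exact: cvg_dot_weak xM xlJ Bl.
  have : beta * (`|B (J p) - B (J l)| * `|B (J p) - B (J l)|) <=
      dot (xt - J l) (B (J p) - B (J l)).
    apply: ler_cvg_to lhs rhs _; apply: filterE => k /=.
    by rewrite -expr2 dotC; exact: B_coco.
  by rewrite xtE subrr dotC dot0r -expr2 Hdot pmulr_rle0.
(* [l - J l = l - xt = p - J p = - mu B (J p) = - mu B (J l)]. *)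
by rewrite /fb_fixpoint /= -BE -pF -{1}xtE /xt subKr.
Qed.

Lemma y_weak_cvg p : fb_fixpoint p ->
  exists2 l, fb_fixpoint l & weak_cvg dot y l.
Proof.
move=> pF; apply: opial; first by exists p.
- exact: fejer_cvg.
- by move=> U l UU sU; exact: weak_cluster_fixpoint pF UU sU.
Qed.

(** The weak limit [p] of [y] is also the reference fixed point, so [x k = y k - v k] tends weakly
    to [p - (p - J p)]. *)
Lemma x_weak_cvg p : fb_fixpoint p -> weak_cvg dot y p -> weak_cvg dot x (J p).
Proof.
move=> pF yp w.
have -> : (fun k => dot (x k) w) = (fun k => dot (y k) w - dot (v k) w).
  by apply/funext => k; rewrite -dotNl -dotDl /v subKr.
rewrite -(subKr p (J p)) dotDl dotNl; apply: cvgB; first exact: yp.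
by apply: cvg_dot; exact: residual_cvg.
Qed.

End forward_backward.

End hilbert_space.

Theorem theorem2p1 (R : realType) (H : completeNormedModType R)
    (dot : {dot H for idfun}) (Hdot : hilbert_dot dot)
    (Phi : H -> \bar R)
    (Phi_proper : proper_fun Phi)
    (Phi_lsc : lower_semicontinuous Phi)
    (Phi_convex : convex_efun Phi)
    (B : H -> H) (beta : R) (beta_gt0 : 0 < beta)
    (B_coco : cocoercive dot beta B)
    (mu h : R) (mu_gt0 : 0 < mu) (mu_lt : mu < 2 * beta)
    (h_gt0 : 0 < h) (h_lt : h < 1 / 2 + Num.min 1 (beta / mu))
    (S_neq0 : inclusion_sols dot Phi B !=set0)
    (x y : nat -> H)
    (x_def : forall k, x k = prox dot mu Phi (y k))
    (y_rec : forall k,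
      y k.+1 = (1 - h) *: y k + h *: (x k - mu *: B (x k))) :
  exists ybar xbar : H,
    (* a *)
    (weak_cvg dot y ybar /\ inclusion_sols dot Phi B (prox dot mu Phi ybar)) /\
    (* b *)
    (xbar = prox dot mu Phi ybar /\ weak_cvg dot x xbar /\
      inclusion_sols dot Phi B xbar) /\
    (* c *)
    ((fun k => B (x k)) @ \oo --> B xbar) /\
    (* d *)
    (cvgn (series (fun k => `|x k.+1 - x k| ^+ 2)) /\
     cvgn (series (fun k => `|y k.+1 - y k| ^+ 2)) /\
     ((fun k => x k.+1 - x k) @ \oo --> (0 : H)) /\
     ((fun k => y k.+1 - y k) @ \oo --> (0 : H))) /\
    (* e *)
    cvgn (fun k => y k - x k).
Proof.
have [z0 [u0 z0u0 uB0]] := S_neq0.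
have p0F := fb_fixpoint_of_sol Hdot Phi_proper Phi_lsc Phi_convex mu_gt0
  z0u0 uB0.
have [ybar yF y_weak] := y_weak_cvg Hdot Phi_proper Phi_lsc Phi_convex B_coco
  beta_gt0 mu_gt0 mu_lt h_gt0 h_lt z0u0 x_def y_rec p0F.
have ySols := fb_fixpoint_sols Hdot Phi_proper Phi_lsc Phi_convex mu_gt0
  z0u0 yF.
have dx := x_increments_summable Hdot Phi_proper Phi_lsc Phi_convex B_coco
  mu_gt0 mu_lt h_gt0 h_lt z0u0 x_def y_rec yF.
have dy := y_increments_summable Hdot Phi_proper Phi_lsc Phi_convex B_coco
  mu_gt0 mu_lt h_gt0 h_lt z0u0 x_def y_rec yF.
(* With [ybar] itself as reference fixed point, the limits of [x k] and [B (x k)] are expressed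
   through its proximal point. *)
exists ybar, (prox dot mu Phi ybar); do !split=> //.
- exact: (x_weak_cvg Hdot Phi_proper Phi_lsc Phi_convex B_coco
    mu_gt0 mu_lt h_gt0 h_lt z0u0 x_def y_rec yF y_weak).
- exact: (operator_cvg Hdot Phi_proper Phi_lsc Phi_convex B_coco
    mu_gt0 mu_lt h_gt0 h_lt z0u0 x_def y_rec yF).
- by apply: sqr_norm_cvg0; exact: cvg_series_cvg_0.
- by apply: sqr_norm_cvg0; exact: cvg_series_cvg_0.
- exact: cvgP (residual_cvg Hdot Phi_proper Phi_lsc Phi_convex B_coco
    mu_gt0 mu_lt h_gt0 h_lt z0u0 x_def y_rec yF).
Qed.
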